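(* For every irrational $\alpha\in(0,1)$ and every $1\le p<\infty$, the Bishop operator $T_\alpha$ on $L^p[0,1)$, given by $T_\alpha f(t)=t\,f(\{t+\alpha\})$, is a limit in operator norm of nilpotent bounded linear operators on $L^p[0,1)$.
   Context: $\{\cdot\}$ denotes the fractional part. An operator $S$ is nilpotent if $S^k=0$ for some positive integer $k$. *)

(* Defs.v *)
From HB Require Import structures.
From mathcomp Require Import all_boot all_order all_algebra.
From mathcomp Require Import generic_quotient ring_quotient complex.
From mathcomp Require Import all_classical all_reals all_analysis.
From mathcomp Require Import measurable_realfun.
From mathcomp Require Import ring lra.

Set Implicit Arguments.
Unset Strict Implicit.
Unset Printing Implicit Defensive.

Import Order.TTheory GRing.Theory Num.Theory.
Import Normc.
Import numFieldNormedType.Exports.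

Local Open Scope classical_set_scope.
Local Open Scope ring_scope.
Local Open Scope quotient_scope.

Section complex_functions.
Context d (T : measurableType d) (R : realType).
Variable mu : {measure set T -> \bar R}.
Variable p : R.
Implicit Types f g : T -> R[i].

(* Borel measurability for the product structure of C = R x R. *)
Definition cmeasurable f :=
  measurable_fun [set: T] (fun x => complex.Re (f x)) /\
  measurable_fun [set: T] (fun x => complex.Im (f x)).

Definition cLnorm f : \bar R := 'N[mu]_p%:E[EFin \o (fun x => normc (f x))]%E.

(* [p1] is a parameter so that the module structures below can be inferred. *)
Definition cLfun (p1 : 1 <= p) : {pred T -> R[i]} :=
  mem [set f | cmeasurable f /\ (cLnorm f < +oo)%E].

Lemma cLfunP p1 f : f \in cLfun p1 <-> cmeasurable f /\ (cLnorm f < +oo)%E.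
Proof. by rewrite inE. Qed.

Lemma normc_ge0 (z : R[i]) : 0 <= normc z.
Proof. by case: z => a b /=; rewrite sqrtr_ge0. Qed.

Lemma measurable_normc f : cmeasurable f ->
  measurable_fun [set: T] (fun x => normc (f x)).
Proof.
move=> [mr mi].
have -> : (fun x => normc (f x)) =
  (fun x => (complex.Re (f x) ^+ 2 + complex.Im (f x) ^+ 2) `^ (2^-1)).
  apply/funext => x; case: (f x) => a b /=.
  by rewrite powR12_sqrt// addr_ge0// sqr_ge0.
apply: (@measurableT_comp _ _ _ _ _ _ (@powR R ^~ 2^-1)) => //.
by apply: measurable_funD; exact: measurable_funX.
Qed.

Lemma cmeasurableD f g : cmeasurable f -> cmeasurable g -> cmeasurable (f + g).
Proof.
move=> [fr fi] [gr gi]; split.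
  rewrite (_ : (fun x => _) =
    (fun x => complex.Re (f x)) \+ (fun x => complex.Re (g x))).
    exact: measurable_funD.
  by apply/funext => x /=; rewrite fctE; case: (f x) (g x) => ? ? [].
rewrite (_ : (fun x => _) =
  (fun x => complex.Im (f x)) \+ (fun x => complex.Im (g x))).
  exact: measurable_funD.
by apply/funext => x /=; rewrite fctE; case: (f x) (g x) => ? ? [].
Qed.

Lemma cmeasurableM f g : cmeasurable f -> cmeasurable g ->
  cmeasurable (fun x => f x * g x).
Proof.
move=> [fr fi] [gr gi]; split.
  rewrite (_ : (fun x => _) =
    (fun x => complex.Re (f x) * complex.Re (g x)
            - complex.Im (f x) * complex.Im (g x))).
    by apply: measurable_funB; exact: measurable_funM.
  by apply/funext => x /=; case: (f x) (g x) => ? ? [].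
rewrite (_ : (fun x => _) =
  (fun x => complex.Re (f x) * complex.Im (g x)
          + complex.Im (f x) * complex.Re (g x))).
  by apply: measurable_funD; exact: measurable_funM.
by apply/funext => x /=; case: (f x) (g x) => ? ? [].
Qed.

Lemma cLnorm_ge0 f : (0 <= cLnorm f)%E.
Proof. exact: Lnorm_ge0. Qed.

Hypothesis p1 : 1 <= p.

Let p0 : 0 < p. Proof. exact: lt_le_trans ltr01 p1. Qed.

Lemma le_cLnorm f g : cmeasurable f -> cmeasurable g ->
  {ae mu, forall x, normc (f x) <= normc (g x)} -> (cLnorm f <= cLnorm g)%E.
Proof.
move=> mf mg fg; rewrite /cLnorm unlock.
apply: gt0_ler_poweR.
- by rewrite invr_ge0 ltW.
- by rewrite in_itv /= leey andbT integral_ge0// => x _; exact: poweR_ge0.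
- by rewrite in_itv /= leey andbT integral_ge0// => x _; exact: poweR_ge0.
apply: ae_ge0_le_integral => //.
- by move=> x _; exact: poweR_ge0.
- apply: (measurableT_comp (measurable_poweR _)).
  by do 2 apply: measurableT_comp => //; exact: measurable_normc.
- by move=> x _; exact: poweR_ge0.
- apply: (measurableT_comp (measurable_poweR _)).
  by do 2 apply: measurableT_comp => //; exact: measurable_normc.
apply: filterS fg => x fg _ /=.
rewrite lee_fin ge0_ler_powR ?nnegrE ?(ltW p0)//.
by rewrite !ger0_norm ?normc_ge0.
Qed.

Lemma eq_cLnorm f g : cmeasurable f -> cmeasurable g ->
  {ae mu, forall x, f x = g x} -> cLnorm f = cLnorm g.
Proof.
move=> mf mg fg; apply/eqP; rewrite eq_le !le_cLnorm//;
  by apply: filterS fg => x ->.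
Qed.

Lemma cLnormD f g : cmeasurable f -> cmeasurable g ->
  (cLnorm (f + g)%R <= cLnorm f + cLnorm g)%E.
Proof.
move=> mf mg.
apply: le_trans (@minkowski_EFin _ _ _ mu (fun x => normc (f x))
  (fun x => normc (g x)) _ _ _ p1); [|exact: measurable_normc..].
rewrite /cLnorm unlock; apply: gt0_ler_poweR.
- by rewrite invr_ge0 ltW.
- by rewrite in_itv /= leey andbT integral_ge0// => x _; exact: poweR_ge0.
- by rewrite in_itv /= leey andbT integral_ge0// => x _; exact: poweR_ge0.
apply: ge0_le_integral => //.
- by move=> x _; exact: poweR_ge0.
- apply: (measurableT_comp (measurable_poweR _)).
  do 2 apply: measurableT_comp => //.
  by apply: measurable_normc; exact: cmeasurableD.
- apply: (measurableT_comp (measurable_poweR _)).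
  do 2 apply: measurableT_comp => //.
  by apply: measurable_funD; exact: measurable_normc.
move=> x _ /=.
rewrite lee_fin ge0_ler_powR ?nnegrE ?(ltW p0)//.
rewrite !ger0_norm ?addr_ge0 ?normc_ge0//; exact: le_normcD.
Qed.

Lemma cLnormZ a f : f \in cLfun p1 ->
  cLnorm (a *: f) = ((normc a)%:E * cLnorm f)%E.
Proof.
move=> /cLfunP[mf ff].
have P : (fun x => normc (f x)) \in Lfun mu p%:E.
  rewrite inE; apply/andP; split; rewrite inE//=; exact: measurable_normc.
have p1' : (1 <= p%:E)%E by rewrite lee_fin.
have := LnormZ (Lfun_Sub p1' P) (normc a).
rewrite Lfun_valP ger0_norm ?normc_ge0// => <-.
apply: eq_Lnorm => x /=; congr EFin.
exact: normcM.
Qed.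

End complex_functions.

Section Lfunctions.
Context d (T : measurableType d) (R : realType).
Variable mu : {measure set T -> \bar R}.
Variables (p : R) (p1 : 1 <= p).

Lemma cLfun_submod_closed : submod_closed (cLfun mu p1).
Proof.
split.
  apply/cLfunP; split.
    by split; exact: (@measurable_cst _ _ _ _ _ (0 : R)).
  rewrite /cLnorm (_ : EFin \o _ = cst 0%E); last first.
    by apply/funext => x /=; rewrite expr0n /= addr0 sqrtr0.
  by rewrite Lnorm0// eqe gt_eqF// (lt_le_trans ltr01).
move=> a f g fL gL; apply/cLfunP.
have [mf ff] := (cLfunP _ _ _).1 fL; have [mg fg] := (cLfunP _ _ _).1 gL.
have maf : cmeasurable (a *: f).
  apply: (@cmeasurableM _ _ _ (cst a)) => //.
split; first exact: cmeasurableD.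
apply: le_lt_trans (cLnormD _ p1 maf mg) _.
rewrite lte_add_pinfty// cLnormZ// lte_mul_pinfty// lee_fin; exact: normc_ge0.
Qed.

HB.instance Definition _ := GRing.isSubmodClosed.Build _ _ (cLfun mu p1)
  cLfun_submod_closed.

Record cLfunType (q1 : 1 <= p) := CLfun {
  cLfun_fun :> T -> R[i] ;
  _ : cLfun_fun \in cLfun mu q1 }.

HB.instance Definition _ := [isSub for @cLfun_fun p1].
HB.instance Definition _ := [Choice of cLfunType p1 by <:].
HB.instance Definition _ := [SubChoice_isSubLmodule of cLfunType p1 by <:].

Implicit Types f g : cLfunType p1.

Lemma cLfun_measurable f : cmeasurable f.
Proof. by have /cLfunP[] := valP f. Qed.

Lemma cLfun_finite f : (cLnorm mu p f < +oo)%E.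
Proof. by have /cLfunP[] := valP f. Qed.

Definition cLnull : {pred cLfunType p1} :=
  mem [set f : cLfunType p1 | {ae mu, forall x, f x = 0}].

Lemma cLnullP f : f \in cLnull <-> {ae mu, forall x, f x = 0}.
Proof. by rewrite inE. Qed.

Lemma cLnull_zmod_closed : zmod_closed cLnull.
Proof.
split; first by apply/cLnullP/aeW.
move=> f g /cLnullP f0 /cLnullP g0; apply/cLnullP.
apply: filterS2 f0 g0 => x fx gx.
by rewrite -[LHS]/(f x - g x) fx gx subr0.
Qed.

HB.instance Definition _ := GRing.isZmodClosed.Build _ cLnull cLnull_zmod_closed.

Lemma cLnullZ a f : f \in cLnull -> a *: f \in cLnull.
Proof.
move=> /cLnullP f0; apply/cLnullP; apply: filterS f0 => x fx.
by rewrite -[LHS]/(a * f x) fx mulr0.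
Qed.

End Lfunctions.
Arguments cLnull {d T R} mu {p} p1.

Section Lspace.
Context d (T : measurableType d) (R : realType).
Variable mu : {measure set T -> \bar R}.
Variables (p : R) (p1 : 1 <= p).

Definition cLspace := Quotient.quot (cLnull mu p1).
HB.instance Definition _ := GRing.Zmodule.on cLspace.
HB.instance Definition _ := EqQuotient.on cLspace.

Implicit Types (f g : cLfunType mu p1) (x y : cLspace).

Lemma cLspace_eqP f g :
  \pi_cLspace f = \pi_cLspace g <-> {ae mu, forall t, f t = g t}.
Proof.
have P : (f - g \in cLnull mu p1) <-> {ae mu, forall t, f t = g t}.
  split=> [/cLnullP|] fg; [|apply/cLnullP]; apply: filterS fg => t.
    by rewrite -[LHS]/(f t - g t) => /eqP; rewrite subr_eq0 => /eqP.
  by move=> fgt; rewrite -[LHS]/(f t - g t) fgt subrr.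
rewrite -P Quotient.idealrBE; split => [->//|/eqP//].
Qed.

Lemma cLspace_reprK f : {ae mu, forall t, repr (\pi_cLspace f) t = f t}.
Proof. by apply/cLspace_eqP; rewrite reprK. Qed.

Lemma cLspaceP x : exists f, x = \pi_cLspace f.
Proof. by exists (repr x); rewrite reprK. Qed.

Lemma cLspace_piD f g : \pi_cLspace (f + g) = \pi_cLspace f + \pi_cLspace g.
Proof. by rewrite !piE. Qed.

Definition cLspace_scale (a : R[i]) x : cLspace := \pi_cLspace (a *: repr x).

Lemma cLspace_scale_pi a f : cLspace_scale a (\pi_cLspace f) = \pi_cLspace (a *: f).
Proof.
apply/cLspace_eqP; apply: filterS (cLspace_reprK f) => t ft.
by rewrite -[LHS]/(a * repr (\pi_cLspace f) t) ft.
Qed.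

Fact cLspace_scalerA a b x :
  cLspace_scale a (cLspace_scale b x) = cLspace_scale (a * b) x.
Proof. by have [f ->] := cLspaceP x; rewrite !cLspace_scale_pi scalerA. Qed.

Fact cLspace_scale1r : left_id 1 cLspace_scale.
Proof. by move=> x; have [f ->] := cLspaceP x; rewrite cLspace_scale_pi scale1r. Qed.

Fact cLspace_scalerDr : right_distributive cLspace_scale +%R.
Proof.
move=> a x y; have [f ->] := cLspaceP x; have [g ->] := cLspaceP y.
by rewrite -cLspace_piD !cLspace_scale_pi scalerDr cLspace_piD.
Qed.

Fact cLspace_scalerDl x : {morph cLspace_scale^~ x : a b / a + b}.
Proof.
move=> a b; have [f ->] := cLspaceP x.
by rewrite !cLspace_scale_pi scalerDl cLspace_piD.
Qed.

HB.instance Definition _ := GRing.Zmodule_isLmodule.Build R[i] cLspace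
  cLspace_scalerA cLspace_scale1r cLspace_scalerDr cLspace_scalerDl.

Lemma cLspace_piZ a f : \pi_cLspace (a *: f) = a *: \pi_cLspace f.
Proof. by rewrite -[RHS]/(cLspace_scale _ _) cLspace_scale_pi. Qed.

Definition cLspace_norm x : R := fine (cLnorm mu p (repr x)).

Lemma cLspace_normE f : (cLspace_norm (\pi_cLspace f))%:E = cLnorm mu p f.
Proof.
rewrite fineK; last by rewrite ge0_fin_numE ?cLnorm_ge0// cLfun_finite.
apply: eq_cLnorm => //; [exact: cLfun_measurable..|exact: cLspace_reprK].
Qed.

Lemma cLspace_normD x y :
  cLspace_norm (x + y) <= cLspace_norm x + cLspace_norm y.
Proof.
have [f ->] := cLspaceP x; have [g ->] := cLspaceP y.
rewrite -lee_fin EFinD -cLspace_piD !cLspace_normE.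
by apply: cLnormD => //; exact: cLfun_measurable.
Qed.

Lemma cLspace_normZ a x : cLspace_norm (a *: x) = normc a * cLspace_norm x.
Proof.
have [f ->] := cLspaceP x; apply: EFin_inj.
by rewrite EFinM -cLspace_piZ !cLspace_normE (cLnormZ _ (valP f)).
Qed.

Lemma cLspace_norm_eq0 x : cLspace_norm x = 0 -> x = 0.
Proof.
have [f ->] := cLspaceP x; move=> nf0.
have f0 : cLnorm mu p f = 0%E by rewrite -cLspace_normE nf0.
have -> : 0 = \pi_cLspace 0 :> cLspace by rewrite piE.
apply/cLspace_eqP.
have /measurable_EFinP mf := measurable_normc (cLfun_measurable f).
have := Lnorm_eq0_eq0 mf _ f0; rewrite lte_fin (lt_le_trans ltr01 p1).
move=> /(_ isT); apply: filterS => t /(_ I) /= [].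
exact: eq0_normc.
Qed.

Lemma cLspace_normMn x n : cLspace_norm (x *+ n) = cLspace_norm x *+ n.
Proof.
rewrite -scaler_nat cLspace_normZ -[RHS]mulr_natl; congr (_ * _).
by rewrite normcMn normc1.
Qed.

Lemma cLspace_normN x : cLspace_norm (- x) = cLspace_norm x.
Proof. by rewrite -scaleN1r cLspace_normZ normcN normc1 mul1r. Qed.

(* The scalars are complex, while the norm takes its values in R. *)
HB.instance Definition _ := Num.Zmodule_isNormed.Build R cLspace
  cLspace_normD cLspace_norm_eq0 cLspace_normMn cLspace_normN.

Lemma cLspace_normrE f : `|\pi_cLspace f|%:E = cLnorm mu p f.
Proof. exact: cLspace_normE. Qed.

End Lspace.

Section unit_interval.
Context {R : realType}.
Local Notation leb := (@lebesgue_measure R).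
Local Notation TR := (measurableTypeR R).

Let m01 : measurable (`[0, 1[%classic : set TR).
Proof. exact: measurable_itv. Qed.

(* Lebesgue measure on [0, 1), carried by the whole line: functions on R modulo
   [leb01]-almost everywhere equality are functions on [0, 1) modulo a.e.
   equality. *)
Definition leb01 : {measure set TR -> \bar R} := mrestr leb m01.

#[global] Instance leb01_ae_filter : Filter (nbhs (almost_everywhere leb01)).
Proof. exact: ae_filter_ringOfSetsType. Qed.

Lemma leb01E (A : set TR) : leb01 A = leb (A `&` `[0, 1[).
Proof. by []. Qed.

Lemma ae_leb01 : {ae leb01, forall t, 0 <= t < 1}.
Proof.
exists (~` `[0, 1[); split => [||t /=]; first exact: measurableC.
  by rewrite leb01E setICl measure0.
by rewrite in_itv.
Qed.

Definition frac_part (x : R) : R := x - (Num.floor x)%:~R.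

Lemma frac_itv x : 0 <= frac_part x < 1.
Proof.
have /andP[lx xl] := floor_itv x.
by rewrite /frac_part subr_ge0 lx ltrBlDl (lt_le_trans xl)// intrD.
Qed.

Lemma frac_shift (a t : R) : 0 <= t < 1 ->
  frac_part (t + a) = if t + frac_part a < 1 then t + frac_part a else t + frac_part a - 1.
Proof.
move=> /andP[t0 t1]; have /andP[a0 a1] := frac_itv a.
have aE : a = frac_part a + (Num.floor a)%:~R by rewrite /frac_part subrK.
rewrite {1}/frac_part; case: ifPn => [lt1|]; last rewrite -leNgt => le1.
  rewrite (_ : Num.floor (t + a) = Num.floor a).
    by rewrite {1}aE; ring.
  apply: floor_def; rewrite intrD {2 3}aE; apply/andP; split; lra.
rewrite (_ : Num.floor (t + a) = Num.floor a + 1).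
  by rewrite {1}aE intrD; ring.
apply: floor_def; rewrite !intrD {2 3}aE; apply/andP; split; lra.
Qed.

Lemma measurable_frac_shift (a : R) :
  measurable_fun [set: TR] (fun t : TR => frac_part (t + a) : TR).
Proof.
apply: (@measurableT_comp _ _ _ _ _ _ frac_part).
  apply: measurable_funB => //; apply: nondecreasing_measurable => //.
  by move=> x y xy; rewrite ler_int; exact: le_floor.
exact: measurable_funD.
Qed.

Lemma measurable_shift (c : R) (A : set TR) : measurable A ->
  measurable ((fun t : TR => t + c : TR) @^-1` A).
Proof.
move=> mA; rewrite -[X in measurable X]setTI.
by apply: measurable_funD.
Qed.

Lemma leb_shift (c : R) (A : set TR) : measurable A ->
  leb ((fun t : TR => t + c : TR) @^-1` A) = leb A.
Proof.
move=> mA.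
have mc : measurable_fun [set: TR] (fun t : TR => t + c : TR).
  exact: measurable_funD.
pose mc_mixin := isMeasurableFun.Build _ _ _ _ _ mc.
pose mc_pack : {mfun TR >-> TR} := HB.pack (fun t : TR => t + c : TR) mc_mixin.
rewrite -[LHS]/(pushforward leb mc_pack A).
apply/esym/lebesgue_measure_unique => //= _ [[x y]] _ <-.
rewrite /pushforward /= (_ : _ @^-1` _ = `]x - c, y - c]%classic).
  rewrite !lebesgue_measure_itv/= !lte_fin ltrD2r; case: ifP => // _.
  by rewrite -!EFinB; congr EFin; ring.
by apply/seteqP; split => t /=; rewrite !in_itv /= ltrBlDr lerBrDr.
Qed.

Lemma leb01_rotation (a : R) (A : set TR) : measurable A ->
  leb01 ((fun t : TR => frac_part (t + a) : TR) @^-1` A) = leb01 A.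
Proof.
move=> mA; rewrite !leb01E; set b := frac_part a.
have /andP[b0 b1] : 0 <= b < 1 := frac_itv a.
pose A1 : set TR := A `&` `[b, 1[; pose A2 : set TR := A `&` `[0, b[.
have mA1 : measurable A1 by apply: measurableI => //; exact: measurable_itv.
have mA2 : measurable A2 by apply: measurableI => //; exact: measurable_itv.
have -> : A `&` `[0, 1[ = A1 `|` A2.
  apply/seteqP; split => [t [At]|t [|] [At]] /=; rewrite !in_itv /=.
  - move=> /andP[t0 t1]; rewrite /A1 /A2 /= !in_itv /= t0 t1.
    by have [bt|tb] := leP b t; [left|right].
  - by move=> /andP[bt ->]; split => //; rewrite (le_trans b0).
  - by move=> /andP[-> tb]; split => //; rewrite (lt_trans tb).
have -> : (fun t : TR => frac_part (t + a) : TR) @^-1` A `&` `[0, 1[ =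
  ((fun t : TR => t + b : TR) @^-1` A1) `|`
  ((fun t : TR => t + (b - 1) : TR) @^-1` A2).
  apply/seteqP; split => [t [/=]|t [|] []] /=; rewrite !in_itv /=.
  - move=> + t01; rewrite frac_shift// -/b; move: t01 => /andP[t0 t1].
    case: ifPn => [lt1|]; last rewrite -leNgt => le1.
      by move=> At; left; split => //=; rewrite in_itv /=; apply/andP; split; lra.
    move=> At; right; rewrite addrA; split => //=; rewrite in_itv /=.
    by apply/andP; split; lra.
  - move=> At /andP[bt t1].
    have t01 : 0 <= t < 1 by apply/andP; split; lra.
    by rewrite frac_shift// -/b t1.
  - move=> At /andP[bt t1].
    have t01 : 0 <= t < 1 by apply/andP; split; lra.
    have tb : (t + b < 1) = false by apply/negbTE; rewrite -leNgt; lra.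
    by rewrite frac_shift// -/b tb -addrA.
rewrite !measureU//.
- by congr (_ + _)%E; exact: leb_shift.
- apply/seteqP; split => // t [] [] _ /= + [] _ /=.
  by rewrite !in_itv /= => /andP[? ?] /andP[? ?]; lra.
- exact: measurable_shift.
- exact: measurable_shift.
- apply/seteqP; split => // t [] [] _ /= + [] _ /=.
  by rewrite !in_itv /= => /andP[? ?] /andP[? ?]; lra.
Qed.

End unit_interval.

Section Bishop.
Context {R : realType}.
Local Notation TR := (measurableTypeR R).
Variables (p : R) (p1 : 1 <= p) (alpha : R).

Definition bishop_fun (f : TR -> R[i]) : TR -> R[i] :=
  fun t => t%:C%C * f (frac_part (t + alpha)).

Lemma bishop_fun_measurable f : cmeasurable f -> cmeasurable (bishop_fun f).
Proof.
move=> [fr fi]; apply: (@cmeasurableM _ TR R (fun t => t%:C%C)).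
  by split => /=; [exact: measurable_id|exact: (@measurable_cst _ _ _ _ _ (0 : R))].
split.
  exact: (measurableT_comp fr (measurable_frac_shift alpha)).
exact: (measurableT_comp fi (measurable_frac_shift alpha)).
Qed.

Lemma ae_rotation (P : TR -> Prop) : {ae leb01, forall t, P t} ->
  {ae leb01, forall t, P (frac_part (t + alpha))}.
Proof.
move=> [A [mA A0 PA]].
exists ((fun t : TR => frac_part (t + alpha) : TR) @^-1` A); split.
- by rewrite -[X in measurable X]setTI; exact: measurable_frac_shift.
- by rewrite leb01_rotation.
- by move=> t /= Pt; apply: PA.
Qed.

Lemma cLnorm_rotation f : cmeasurable f ->
  cLnorm leb01 p (fun t => f (frac_part (t + alpha))) = cLnorm leb01 p f.
Proof.
move=> mf; rewrite /cLnorm unlock; congr (_ `^ _)%E.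
set g := fun t : TR => (`|(EFin \o (fun x => normc (f x))) t| `^ p)%E.
have mg : measurable_fun [set: TR] g.
  apply: (measurableT_comp (measurable_poweR _)).
  by do 2 apply: measurableT_comp => //; exact: measurable_normc.
transitivity (\int[pushforward leb01
    (fun t : TR => frac_part (t + alpha) : TR)]_t g t)%E; last first.
  apply: eq_measure_integral; first exact: measurable_frac_shift.
  by move=> ? A mA _; exact: leb01_rotation.
rewrite ge0_integral_pushforward//; first exact: measurable_frac_shift.
by move=> y _; exact: poweR_ge0.
Qed.

Lemma bishop_fun_Lfun f : f \in cLfun leb01 p1 ->
  bishop_fun f \in cLfun leb01 p1.
Proof.
move=> /cLfunP[mf ff]; apply/cLfunP.
have mb := bishop_fun_measurable mf; split => //.
apply: le_lt_trans ff; rewrite -(cLnorm_rotation mf).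
have mr : cmeasurable (fun t : TR => f (frac_part (t + alpha))).
  case: mf => fr fi; split.
    exact: (measurableT_comp fr (measurable_frac_shift alpha)).
  exact: (measurableT_comp fi (measurable_frac_shift alpha)).
apply: le_cLnorm => //; apply: filterS (@ae_leb01 R) => t /andP[t0 t1].
rewrite normcM ler_piMl ?normc_ge0//=.
by rewrite expr0n addr0 sqrtr_sqr ger0_norm// ltW.
Qed.

Definition bishop_Lfun (f : cLfunType leb01 p1) : cLfunType leb01 p1 :=
  CLfun (bishop_fun_Lfun (valP f)).

Local Notation Lp := (cLspace leb01 p1).

Definition Bishop (x : Lp) : Lp := \pi_Lp (bishop_Lfun (repr x)).

Lemma BishopE f : Bishop (\pi_Lp f) = \pi_Lp (bishop_Lfun f).
Proof.
apply/cLspace_eqP.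
apply: filterS (ae_rotation (cLspace_reprK f)) => t ft.
by rewrite /= /bishop_fun ft.
Qed.

Lemma Bishop_linear : linear Bishop.
Proof.
move=> a x y; have [f ->] := cLspaceP x; have [g ->] := cLspaceP y.
rewrite -cLspace_piZ -cLspace_piD !BishopE -cLspace_piZ -cLspace_piD.
congr (\pi_Lp _); apply: val_inj; apply/funext => t /=.
rewrite -[LHS]/(t%:C%C * (a * f _ + g _)) -[RHS]/(a * (_ * f _) + _ * g _).
by rewrite mulrDr mulrCA.
Qed.

HB.instance Definition _ := GRing.isLinear.Build R[i] Lp Lp _ Bishop Bishop_linear.

End Bishop.

Section operators.
Context {R : realType} {V : normedZmodType R}.
Implicit Types S : V -> V.

(* Extended-real-valued, so that an unbounded operator has norm +oo. *)
Definition opnorm S : \bar R :=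
  ereal_sup [set `|S x|%:E | x in [set x : V | `|x| <= 1]].

Definition bounded_operator S := exists M : R, forall x, `|S x| <= M * `|x|.

Definition nilpotent_operator S :=
  exists k : nat, (0 < k)%N /\ forall x, iter k S x = 0.

End operators.

(* Main.v *)
(* Replace the weight [t] by [0] on [0, eps): this moves the Bishop operator by at
   most [eps] in norm.  The [K]-th power of the new operator multiplies by the
   product of the truncated weight along the first [K] points of the orbit of [t]
   under the rotation, and since alpha is irrational there is a [K] such that all
   these orbit segments meet [0, eps). *)
Require Import Defs.
From HB Require Import structures.
From mathcomp Require Import all_boot all_order all_algebra complex.
From mathcomp Require Import all_classical all_reals all_analysis.
From mathcomp Require Import measurable_realfun lra.

Import Order.TTheory GRing.Theory Num.Theory.
Import numFieldNormedType.Exports.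
Import Normc.

Local Open Scope classical_set_scope.
Local Open Scope ring_scope.
Local Open Scope quotient_scope.
Local Open Scope complex_scope.

(** * Fractional parts and orbits of an irrational rotation *)

Section orbits.
Context {R : realType}.
Implicit Types (a x y eps : R) (k : int).

Lemma frac_part_def x y k : x = y + k%:~R -> 0 <= y < 1 -> frac_part x = y.
Proof.
move=> -> /andP[y0 y1]; rewrite /frac_part (@floor_def _ _ k) ?addrK//.
by rewrite intrD; apply/andP; split; lra.
Qed.

Lemma frac_part_decomp x : x = frac_part x + (Num.floor x)%:~R.
Proof. by rewrite /frac_part subrK. Qed.

Lemma frac_part_id x : 0 <= x < 1 -> frac_part x = x.
Proof. by apply: (@frac_part_def _ _ 0); rewrite addr0. Qed.

Lemma frac_partDl x y : frac_part (frac_part x + y) = frac_part (x + y).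
Proof.
apply/esym; apply: (@frac_part_def _ _ (Num.floor x + Num.floor (frac_part x + y))).
  by rewrite intrD addrCA -frac_part_decomp addrA [_%:~R + _]addrC -frac_part_decomp.
exact: frac_itv.
Qed.

(** Dirichlet's pigeonhole argument: of the [m.+2] multiples of [a], two have fractional parts in
    the same one of [m.+1] intervals of length [1 / m.+1 < eps]. *)
Lemma irrational_small_multiple a eps : irrational a -> 0 < eps ->
  exists (q : nat) (k : int), 0 < `|q%:R * a - k%:~R| < eps.
Proof.
move=> irr_a eps0; pose m := Num.truncn eps^-1.
pose f (j : 'I_m.+2) : 'I_m.+1 :=
  inord (Num.truncn (m.+1%:R * frac_part (j%:R * a))).
(* Fractional parts are below 1, so the truncation stays below [m.+1] and [inord] does not fall back
   on its default value. *)
have fE j : (f j = Num.truncn (m.+1%:R * frac_part (j%:R * a)) :> nat).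
  rewrite inordK// -(@ltr_nat R).
  have /andP[f0 f1] := frac_itv (j%:R * a).
  apply: (@le_lt_trans _ _ (m.+1%:R * frac_part (j%:R * a))).
    by rewrite truncn_le mulr_ge0.
  by rewrite gtr_pMr// ltr0n.
have [i [j [ltij fij]]] : exists i j : 'I_m.+2, (i < j)%N /\ f i = f j.
  have /injectivePn[i [j neij fij]] : ~~ injectiveb f.
    by apply/negP => /injectiveP /leq_card; rewrite !card_ord ltnn.
  have [ltij|ltji|/val_inj eij] := ltngtP i j; [by exists i, j|by exists j, i|].
  by rewrite eij eqxx in neij.
exists (j - i)%N, (Num.floor (j%:R * a) - Num.floor (i%:R * a)).
set d := (X in `|X|).
have dE : d = frac_part (j%:R * a) - frac_part (i%:R * a).
  by rewrite /d natrB ?(ltnW ltij)// intrB /frac_part; lra.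
apply/andP; split.
  (* If [d] were 0, [a] would be an integer divided by [j - i]. *)
  rewrite normr_gt0; apply/eqP => d0; apply: irr_a.
  exists ((Num.floor (j%:R * a) - Num.floor (i%:R * a))%:~R / (j - i)%N%:R) => //.
  have ij0 : (j - i)%N%:R != 0 :> R by rewrite pnatr_eq0 subn_eq0 -ltnNge.
  have /eqP := d0; rewrite subr_eq0 => /eqP dk.
  by rewrite fmorph_div /= ratr_int ratr_nat -dk mulrAC divff// mul1r.
have m0 : 0 < m.+1%:R :> R by rewrite ltr0n.
have : `|m.+1%:R * d| < 1.
  have tr l : (f l)%:R <= m.+1%:R * frac_part (l%:R * a) < (f l)%:R + 1.
    have /andP[f0 _] := frac_itv (l%:R * a).
    by rewrite fE natr1 truncn_itv// mulr_ge0.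
  have /andP[? ?] := tr i; have := tr j; rewrite -fij => /andP[? ?].
  by rewrite dE ltr_norml mulrBr; apply/andP; split; lra.
rewrite normrM gtr0_norm// mulrC -ltr_pdivlMr// mul1r => /lt_le_trans; apply.
rewrite -[leRHS]invrK lef_pV2 ?posrE ?invr_gt0// ltW//.
exact: truncnS_gt.
Qed.

(* Some multiple of [a] is congruent mod 1 to a nonzero [d] with [|d| < eps]:
   rotating by [d] cannot jump over [0, eps), and goes once around the circle
   in at most [1 / |d| + 1] steps. *)
Lemma irrational_orbit_hits a eps : irrational a -> 0 < eps ->
  exists n : nat, forall x, exists2 j, (j < n)%N & frac_part (x + j%:R * a) < eps.
Proof.
move=> irr_a eps0.
(* The minimum with 1 gives [|d| < 1], which keeps the landing point [y] below 1. *)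
have eps1 : 0 < Num.min eps 1 by rewrite lt_min eps0 ltr01.
have [q [k /andP[]]] := irrational_small_multiple _ _ irr_a eps1.
set d := _ - _; rewrite lt_min => d0 /andP[deps d1].
(* Modulo 1, [m * q] rotations by [a] amount to [m] rotations by [d]. *)
have step m x : x + (m * q)%N%:R * a =
    frac_part x + m%:R * d + (Num.floor x + m%:Z * k)%:~R.
  rewrite [in LHS](frac_part_decomp x) /d natrM intrD intrM.
  by rewrite mulrBr -mulrA -[(m%:Z)%:~R]/(m%:R); lra.
clearbody d.
exists ((Num.truncn `|d|^-1).+1 * q).+1 => x.
suff [m mle [y y01 [yeps [l yE]]]] : exists2 m, (m <= (Num.truncn `|d|^-1).+1)%N &
    exists2 y, 0 <= y < 1 & y < eps /\ exists l : int, frac_part x + m%:R * d = y + l%:~R.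
  exists (m * q)%N; first by rewrite ltnS leq_mul2r mle orbT.
  rewrite (@frac_part_def _ y (l + (Num.floor x + m%:Z * k)))//.
  by rewrite step yE [in RHS]intrD addrA.
have /andP[x0 x1] := frac_itv x; set u := frac_part x in x0 x1 *.
have trunc_le v : 0 <= v <= 1 -> (Num.truncn (v / `|d|) <= Num.truncn `|d|^-1)%N.
  move=> /andP[v0 v1]; apply: le_truncn.
  by rewrite ler_piMl// invr_ge0.
have trunc_itv v : 0 <= v ->
    (Num.truncn (v / `|d|))%:R * `|d| <= v < (Num.truncn (v / `|d|))%:R * `|d| + `|d|.
  move=> v0; have := @truncn_itv _ (v / `|d|); rewrite divr_ge0// => /(_ isT).
  by rewrite ler_pdivlMr// ltr_pdivrMr// -natr1 mulrDl mul1r.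
have [dpos|dneg] := leP 0 d.
- have v0 : 0 <= 1 - u <= 1 by apply/andP; split; lra.
  have /andP[v0' _] := v0.
  (* The first step that carries [u] beyond 1: it overshoots by at most [d], and one turn is then
     removed. *)
  exists (Num.truncn ((1 - u) / `|d|)).+1; first by rewrite ltnS trunc_le.
  have := trunc_itv _ v0'; rewrite ger0_norm// in deps d1 *.
  rewrite -natr1 [(_ + 1) * d]mulrDl mul1r; set M := _%:R * d => /andP[Ml Mr].
  exists (u + M + d - 1); first by apply/andP; split; lra.
  split; first lra.
  by exists 1; rewrite mulr1z; lra.
(* Moving downwards, this is the last step before falling below 0, so what is left is less than
   [|d|]. *)
- exists (Num.truncn (u / `|d|)).
    by rewrite (leq_trans (trunc_le _ _))//; apply/andP; split; lra.
  have := trunc_itv _ x0; rewrite ltr0_norm// in deps d1 *.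
  rewrite mulrN; set M := _%:R * d => /andP[Ml Mr].
  exists (u + M); first by apply/andP; split; lra.
  split; first lra.
  by exists 0; rewrite addr0.
Qed.

End orbits.

(** * Weighted rotation operators: norm bound and nilpotency *)

Section weighted_rotation.
Context {R : realType}.
Local Notation TR := (measurableTypeR R).
Variables (p : R) (p1 : 1 <= p) (a : R).
Local Notation Lp := (cLspace leb01 p1).
Implicit Type f : cLfunType leb01 p1.

Lemma cmeasurable_rotation (f : TR -> R[i]) : cmeasurable f ->
  cmeasurable (fun t : TR => f (frac_part (t + a))).
Proof.
by case=> fr fi; split;
  [apply: (measurableT_comp fr)|apply: (measurableT_comp fi)];
  exact: measurable_frac_shift.
Qed.

Variables (w : TR -> R) (c : R).
Hypotheses (mw : measurable_fun [set: TR] w) (c0 : 0 <= c).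
Hypothesis wc : forall t, 0 <= t < 1 -> `|w t| <= c.

(** Keeping the weight general covers both the nilpotent approximants and their differences from the
    Bishop operator. *)
Definition weighted_rotation_fun (f : TR -> R[i]) : TR -> R[i] :=
  fun t => (w t)%:C * f (frac_part (t + a)).

Lemma cmeasurable_weighted_rotation f : cmeasurable f ->
  cmeasurable (weighted_rotation_fun f).
Proof.
move=> /cmeasurable_rotation; apply: (@cmeasurableM _ TR R (fun t => (w t)%:C)).
by split => //=; exact: (@measurable_cst _ _ _ _ _ (0 : R)).
Qed.

(** On [0, 1) the modulus is dominated by that of [c] times the rotated [f], and rotation preserves
    the norm. *)
Lemma cLnorm_weighted_rotation f :
  (cLnorm leb01 p (weighted_rotation_fun f) <= c%:E * cLnorm leb01 p f)%E.
Proof.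
have mf := cLfun_measurable f; have mrf := cmeasurable_rotation _ mf.
have rfL : (fun t : TR => f (frac_part (t + a))) \in cLfun leb01 p1.
  by apply/cLfunP; split; rewrite ?cLnorm_rotation// cLfun_finite.
have ncE : normc c%:C = c by rewrite /= expr0n addr0 sqrtr_sqr ger0_norm.
rewrite -(cLnorm_rotation p a mf) -{1}ncE -(cLnormZ _ rfL).
apply: le_cLnorm => //; first exact: cmeasurable_weighted_rotation.
  apply: (@cmeasurableM _ TR R (cst c%:C)) => //; split => /=;
    exact: measurable_cst.
apply: filterS (@ae_leb01 R) => t t01.
rewrite -[X in _ <= normc X]/(c%:C * f _) !normcM ncE ler_wpM2r ?normc_ge0//.
by rewrite /= expr0n addr0 sqrtr_sqr wc.
Qed.

Lemma weighted_rotation_Lfun_subproof f :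
  weighted_rotation_fun f \in cLfun leb01 p1.
Proof.
apply/cLfunP; split.
  exact: cmeasurable_weighted_rotation (cLfun_measurable f).
apply: le_lt_trans (cLnorm_weighted_rotation f) _.
by rewrite lte_mul_pinfty// cLfun_finite.
Qed.

Definition weighted_rotation_Lfun f : cLfunType leb01 p1 :=
  CLfun (weighted_rotation_Lfun_subproof f).

Definition weighted_rotation (x : Lp) : Lp :=
  \pi_Lp (weighted_rotation_Lfun (repr x)).

Lemma weighted_rotationE f :
  weighted_rotation (\pi_Lp f) = \pi_Lp (weighted_rotation_Lfun f).
Proof.
apply/cLspace_eqP; apply: filterS (ae_rotation a (cLspace_reprK f)) => t ft.
by rewrite /= /weighted_rotation_fun ft.
Qed.

Lemma weighted_rotation_linear : linear weighted_rotation.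
Proof.
move=> b x y; have [f ->] := cLspaceP x; have [g ->] := cLspaceP y.
rewrite -cLspace_piZ -cLspace_piD !weighted_rotationE -cLspace_piZ -cLspace_piD.
congr (\pi_Lp _); apply: val_inj; apply/funext => t /=.
rewrite -[LHS]/((w t)%:C * (b * f _ + g _)) -[RHS]/(b * (_ * f _) + _ * g _).
by rewrite mulrDr mulrCA.
Qed.

HB.instance Definition _ :=
  GRing.isLinear.Build R[i] Lp Lp _ weighted_rotation weighted_rotation_linear.

Lemma weighted_rotation_norm x : `|weighted_rotation x| <= c * `|x|.
Proof.
have [f ->] := cLspaceP x; rewrite weighted_rotationE -lee_fin EFinM.
by rewrite !cLspace_normrE cLnorm_weighted_rotation.
Qed.

Lemma opnorm_weighted_rotation_le : (opnorm weighted_rotation <= c%:E)%E.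
Proof.
apply: ge_ereal_sup => _ [x /= x1 <-]; rewrite lee_fin.
by rewrite (le_trans (weighted_rotation_norm x))// ler_piMr.
Qed.

Lemma iter_weighted_rotationE n f :
  iter n weighted_rotation (\pi_Lp f) = \pi_Lp (iter n weighted_rotation_Lfun f).
Proof. by elim: n => //= n ->; rewrite weighted_rotationE. Qed.

(** The iterate at [t] is a value of [f] times the weights at the first [n] orbit points, so a
    single zero weight kills it. *)
Lemma iter_weighted_rotation_eq0 n f (t : R) : 0 <= t < 1 ->
  (exists2 j, (j < n)%N & w (frac_part (t + j%:R * a)) = 0) ->
  iter n weighted_rotation_Lfun f t = 0.
Proof.
elim: n t => [|n IHn] t t01 [[|j] jn wj] //=; rewrite /weighted_rotation_fun.
  by rewrite mul0r addr0 frac_part_id in wj; rewrite // wj mul0r.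
rewrite IHn ?mulr0//; first exact: frac_itv.
exists j => //; rewrite frac_partDl -addrA.
by rewrite -{1}[a]mul1r -mulrDl [1 + _]addrC natr1.
Qed.

Lemma nilpotent_weighted_rotation n :
  (forall t, exists2 j, (j < n)%N & w (frac_part (t + j%:R * a)) = 0) ->
  nilpotent_operator weighted_rotation.
Proof.
(* Some [j < n] exists for the starting point 0, which forces [n] to be positive. *)
move=> hit; exists n; split; first by have [j /(leq_ltn_trans (leq0n j))] := hit 0.
move=> x; have [f ->] := cLspaceP x; rewrite iter_weighted_rotationE.
have -> : 0 = \pi_Lp 0 by rewrite piE.
apply/cLspace_eqP; apply: filterS (@ae_leb01 R) => t t01.
exact: iter_weighted_rotation_eq0.
Qed.

End weighted_rotation.

(** * Convergence in operator norm and the approximating sequence *)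

Lemma cvg_opnorm_harmonic {R : realType} {V : normedZmodType R} (S : nat -> V -> V) :
  (forall n, S n 0 = 0) -> (forall n, opnorm (S n) <= (harmonic n)%:E)%E ->
  opnorm (S n) @[n --> \oo] --> 0%E.
Proof.
move=> S0 Sh.
apply: (@squeeze_cvge _ _ _ _ (cst 0%E) _ (EFin \o harmonic)).
(* The image of the zero vector puts 0 in the set whose supremum is taken, hence the lower bound. *)
- apply: nearW => n; rewrite Sh andbT; apply: ereal_sup_ubound.
  by exists 0; rewrite /= ?S0 ?normr0 ?ler01.
- exact: cvg_cst.
- apply/fine_cvgP; split; [exact: nearW|exact: cvg_harmonic].
Qed.

Theorem mainTheorem5 (R : realType) (alpha : R)
    (alpha_irr : irrational alpha) (alpha01 : 0 < alpha < 1)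
    (p : R) (p1 : 1 <= p) :
  exists N : nat -> {linear cLspace leb01 p1 -> cLspace leb01 p1},
    (forall n, bounded_operator (N n)) /\
    (forall n, nilpotent_operator (N n)) /\
    opnorm (fun f => Bishop alpha f - N n f) @[n --> \oo] --> 0%E.
Proof.
pose eps n : R := harmonic n.
have eps0 n : 0 < eps n by rewrite invr_gt0 ltr0n.
(* The weight [t] splits as [w n t + v n t]: [w n] defines the nilpotent approximant, and [v n], at
   most [eps n] on [0, 1), carries the error. *)
pose w n (t : measurableTypeR R) : R := if t < eps n then 0 else t.
pose v n (t : measurableTypeR R) : R := if t < eps n then t else 0.
have mlt n : measurable_fun [set: measurableTypeR R] (fun t : R => t < eps n).
  exact: measurable_fun_ltr.
have mw n : measurable_fun [set: measurableTypeR R] (w n).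
  exact: measurable_fun_ifT.
have mv n : measurable_fun [set: measurableTypeR R] (v n).
  exact: measurable_fun_ifT.
have w1 n t : 0 <= t < 1 -> `|w n t| <= 1.
  by rewrite /w => /andP[t0 t1]; case: ifP; rewrite ?normr0// ger0_norm// ltW.
have veps n t : 0 <= t < 1 -> `|v n t| <= eps n.
  rewrite /v => /andP[t0 t1]; case: ifP => [/ltW|]; rewrite ?normr0 ?ger0_norm// => _.
  exact: ltW.
pose N n := weighted_rotation _ p1 alpha _ _ (mw n) ler01 (w1 n).
have BN n f : Bishop alpha f - N n f =
    weighted_rotation _ p1 alpha _ _ (mv n) (ltW (eps0 n)) (veps n) f.
  have [g ->] := cLspaceP f; rewrite /N /= BishopE 2!weighted_rotationE.
  apply/eqP; rewrite subr_eq -cLspace_piD; apply/eqP.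
  congr (\pi_(cLspace _ _) _); apply: val_inj; apply/funext => t.
  rewrite -[LHS]/(t%:C * g _) -[RHS]/((v n t)%:C * g _ + (w n t)%:C * g _).
  by rewrite -mulrDl -rmorphD /v /w; case: ifP; rewrite ?addr0 ?add0r.
exists N; split; [|split] => [n|n|].
- by exists 1 => x; exact: weighted_rotation_norm.
- have [K hit] := irrational_orbit_hits _ _ alpha_irr (eps0 n).
  apply: (@nilpotent_weighted_rotation _ _ _ _ _ _ _ _ _ K) => t.
  (* An orbit point below [eps n] is a zero of [w n]. *)
  by have [j jK jeps] := hit t; exists j => //; rewrite /w jeps.
- apply: cvg_opnorm_harmonic => n; first by rewrite BN raddf0.
  rewrite [X in opnorm X](_ : _ =
    weighted_rotation _ p1 alpha _ _ (mv n) (ltW (eps0 n)) (veps n)).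
    exact: opnorm_weighted_rotation_le.
  by apply/funext => f; exact: BN.
Qed.
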